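(* Let $A\in\mathbb{R}^{d\times d}$ be symmetric positive definite, $b\in\mathbb{R}^d$, $f(x)=\frac12 x^\top A x-b^\top x$, $x_*=A^{-1}b$, $m=\lambda_{\min}(A)$, $L=\lambda_{\max}(A)$ with $m<L$, and $\kappa=L/m$. Let $K\ge 1$ be an integer and let $\sigma$ be any permutation of $\{1,\dots,K\}$. For any $x_1\in\mathbb{R}^d$, the output $x_{K+1}$ of Frictionless Hamiltonian Descent run on $f$ from $x_1$ for $K$ iterations with integration times $$\eta_k=\frac{\pi}{2}\,\frac{1}{\sqrt{r^{(K)}_{\sigma(k)}}},\qquad k=1,\dots,K,$$ satisfies $$\|x_{K+1}-x_*\|_2\le \max_{\lambda\in[m,L]}\left|\bar\Phi_K(\lambda)\right|\,\|x_1-x_*\|_2\le \frac{2}{\left(\frac{\sqrt\kappa+1}{\sqrt\kappa-1}\right)^K+\left(\frac{\sqrt\kappa+1}{\sqrt\kappa-1}\right)^{-K}}\,\|x_1-x_*\|_2 .$$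
   Context: Hamiltonian Flow: for $f:\mathbb{R}^d\to\mathbb{R}$, $\mathsf{HF}_\eta(x_0,v_0)=(x_\eta,v_\eta)$ denotes the value at time $t=\eta$ of the solution of $\frac{dx}{dt}=v$, $\frac{dv}{dt}=-\nabla f(x)$ with initial condition $(x_0,v_0)$ at $t=0$. Frictionless Hamiltonian Descent (Frictionless-HD) with integration times $\{\eta_k\}_{k=1}^K$: starting from $x_1$, for $k=1,\dots,K$ set $(x_{k+1},v_{k+1})=\mathsf{HF}_{\eta_k}(x_k,0)$ (the velocity is reset to zero before each flow); output $x_{K+1}$. For $k=1,\dots,K$, $r_k^{(K)}:=\frac{L+m}{2}-\frac{L-m}{2}\cos\left(\frac{(k-\frac12)\pi}{K}\right)$. The scaled-and-shifted Chebyshev polynomial is $\bar\Phi_K(\lambda):=\frac{\Phi_K(h(\lambda))}{\Phi_K(h(0))}$ with $h(\lambda):=\frac{L+m-2\lambda}{L-m}$, where $\Phi_K$ is the degree-$K$ Chebyshev polynomial of the first kind. *)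

(* Defs.v *)
From HB Require Import structures.
From mathcomp Require Import all_boot all_order all_algebra all_fingroup.
From mathcomp Require Import all_classical all_reals all_analysis.

Set Implicit Arguments.
Unset Strict Implicit.
Unset Printing Implicit Defensive.

Import Order.TTheory GRing.Theory Num.Theory.
Import numFieldNormedType.Exports.

Local Open Scope classical_set_scope.
Local Open Scope ring_scope.

(* The library norm `|x| on 'cV[R]_d is the sup norm. *)
Definition norm2 (R : realType) (d : nat) (x : 'cV[R]_d) : R :=
  Num.sqrt (\sum_(i < d) x i 0 ^+ 2).

Definition posdefmx (R : realType) (d : nat) (A : 'M[R]_d) : Prop :=
  A^T = A /\ forall u : 'cV[R]_d, u != 0 -> 0 < (u^T *m A *m u) 0 0.

Definition is_max (R : realType) (S : set R) (M : R) : Prop :=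
  S M /\ forall s, S s -> s <= M.

Definition is_min (R : realType) (S : set R) (M : R) : Prop :=
  S M /\ forall s, S s -> M <= s.

Definition spectrum (R : realType) (d : nat) (A : 'M[R]_d) : set R :=
  [set mu | eigenvalue A mu].

Definition quadratic (R : realType) (d : nat) (A : 'M[R]_d) (b x : 'cV[R]_d)
    : R :=
  2^-1 * (x^T *m A *m x) 0 0 - (b^T *m x) 0 0.

Definition grad (R : realType) (d : nat) (f : 'cV[R]_d -> R) (x : 'cV[R]_d)
    : 'cV[R]_d :=
  \col_(i < d) 'D_(delta_mx i 0) f x.

(* Solutions are functions on the whole of R that are only constrained on     *)
(* [0, eta] (with 0 <= eta). Two-sided derivatives at the end points lose no  *)
(* generality, a C^1 function on [0, eta] being extendable past them.         *)
Definition hamiltonian_solution (R : realType) (d : nat) (f : 'cV[R]_d -> R)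
    (eta : R) (x0 v0 : 'cV[R]_d) (x v : R -> 'cV[R]_d) : Prop :=
  [/\ x 0 = x0, v 0 = v0 &
      forall t : R, 0 <= t <= eta ->
        is_derive t (1 : R) x (v t) /\
        is_derive t (1 : R) v (- grad f (x t))].

(* The value at eta of the solution, picked by choice; the default 0 is used  *)
(* only if there is no solution on [0, eta].                                  *)
Definition hamiltonian_flow (R : realType) (d : nat) (f : 'cV[R]_d -> R)
    (eta : R) (x0 v0 : 'cV[R]_d) : 'cV[R]_d * 'cV[R]_d :=
  xget (0, 0) [set z | exists x v : R -> 'cV[R]_d,
    hamiltonian_solution f eta x0 v0 x v /\ z = (x eta, v eta)].

(* For etas = [:: eta_1; ...; eta_K] this is the output x_(K+1).              *)
Definition frictionless_hd (R : realType) (d : nat) (f : 'cV[R]_d -> R)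
    (etas : seq R) (x1 : 'cV[R]_d) : 'cV[R]_d :=
  foldl (fun x eta => (hamiltonian_flow f eta x 0).1) x1 etas.

(* r_k^(K), with k ranging over 1, ..., K.                                    *)
Definition cheb_root (R : realType) (m L : R) (K k : nat) : R :=
  (L + m) / 2 - (L - m) / 2 * cos ((k%:R - 2^-1) * pi / K%:R).

Fixpoint chebyshev_poly (R : realType) (n : nat) : {poly R} :=
  if n is n1.+1 then
    if n1 is n2.+1 then 2 *: 'X * chebyshev_poly R n1 - chebyshev_poly R n2
    else 'X
  else 1.

Definition cheb_shift (R : realType) (m L lam : R) : R :=
  (L + m - 2 * lam) / (L - m).

Definition scaled_chebyshev (R : realType) (m L : R) (K : nat) (lam : R) : R :=
  (chebyshev_poly R K).[cheb_shift m L lam] /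
  (chebyshev_poly R K).[cheb_shift m L 0].

(* Main.v *)
Require Import Defs.
From HB Require Import structures.
From mathcomp Require Import all_boot all_order all_algebra all_fingroup.
From mathcomp Require Import all_classical all_reals all_analysis.
From mathcomp Require Import spectral complex ring lra.

Set Implicit Arguments.
Unset Strict Implicit.
Unset Printing Implicit Defensive.

Import Order.TTheory GRing.Theory Num.Theory.
Import numFieldNormedType.Exports.

Local Open Scope classical_set_scope.
Local Open Scope ring_scope.

(* In an eigendirection of A with eigenvalue lam, a flow of duration eta from
   rest multiplies the deviation from x_* by cos (sqrt lam * eta), so K flows
   multiply it by prod_k cos (pi/2 * sqrt (lam / r_k)). The elementary bound
   |cos (pi/2 * y)| <= |1 - y^2| dominates this product by
   prod_k |1 - lam / r_k|, which is |scaled_chebyshev m L K lam| since the r_k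
   are its roots and its value at 0 is 1. Its maximum over [m, L] is
   1 / T_K(h(0)), attained at lam = m, and h(0) = (q + 1/q) / 2 gives
   T_K(h(0)) = (q^K + q^-K) / 2: the second inequality is an equality. *)

(** * Spectral decomposition of a real symmetric matrix *)

(* The rows are the real and imaginary parts of the rows of a unitary matrix
   diagonalizing A over R[i]: a tight frame instead of an orthonormal basis. *)
Lemma symmetric_eigenframe (R : rcfType) (d : nat) (A : 'M[R]_d) :
  A^T = A ->
  exists (U : 'M[R]_(d + d, d)) (D : 'I_(d + d) -> R),
    [/\ forall i j, (U *m A) i j = D i * U i j,
        U^T *m U = 1%:M & forall i, eigenvalue A (D i)].
Proof.
move=> symA; set C := R[i].
pose AC : 'M[C]_d := map_mx (real_complex R) A.
have hermAC : AC \is hermsymmx.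
  apply: realsym_hermsym.
    by apply/is_hermitianmxP; rewrite expr0 scale1r /AC map_mx_id // map_trmx
      symA.
  by apply/mxOverP => i j; rewrite mxE complex_real.
pose P := spectralmx AC.
have Punit : P \in unitmx by apply: spectral_unit.
have PA : P *m AC = diag_mx (spectral_diag AC) *m P.
  have /hermitian_normalmx /orthomx_spectralP {1}-> := hermAC.
  by rewrite -mulmxA mulKVmx.
pose D : 'rV_d := map_mx (@complex.Re R) (spectral_diag AC).
have DE i : spectral_diag AC 0 i = (D 0 i)%:C%C.
  have /mxOverP/(_ 0 i) := hermitian_spectral_diag_real hermAC.
  by move=> /complex_realP[r ri]; rewrite mxE ri.
(* As [A] and [D] have real entries, this relation splits into one for the real parts and one for
   the imaginary parts of [P]. *)
have PAE i j : \sum_k P i k * (A k j)%:C%C = (D 0 i)%:C%C * P i j.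
  have /matrixP/(_ i j) := PA; rewrite mul_diag_mx !mxE DE mxE => <-.
  by apply: eq_bigr => k _; rewrite mxE.
have ReM (z : C) (r : R) : complex.Re (z * r%:C%C) = complex.Re z * r.
  by case: z => x y /=; rewrite mulr0 subr0.
have ImM (z : C) (r : R) : complex.Im (z * r%:C%C) = complex.Im z * r.
  by case: z => x y /=; rewrite mulr0 add0r.
pose U := col_mx (map_mx (@complex.Re R) P) (map_mx (@complex.Im R) P).
exists U, (fun i => row_mx D D 0 i); split.
- move=> i j; rewrite mul_col_mx; case: (split_ordP i) => k ->.
    have /(congr1 (@complex.Re R)) := PAE k j.
    rewrite !col_mxEu row_mxEl raddf_sum mulrC ReM [RHS]mulrC
      [map_mx _ _ _ _]mxE => <-.
    by rewrite mxE; apply: eq_bigr => l _; rewrite [RHS]ReM mxE.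
  have /(congr1 (@complex.Im R)) := PAE k j.
  rewrite !col_mxEd row_mxEr raddf_sum mulrC ImM [RHS]mulrC
    [map_mx _ _ _ _]mxE => <-.
  by rewrite mxE; apply: eq_bigr => l _; rewrite [RHS]ImM mxE.
(* The real part of P^* P is (Re P)^T (Re P) + (Im P)^T (Im P), that is U^T U. *)
- have : (P^t* )%sesqui *m P = 1%:M.
    by rewrite -invmx_unitary ?spectral_unitarymx// mulVmx.
  rewrite /U tr_col_mx mul_row_col => /matrixP PP; apply/matrixP => i j.
  have /(congr1 (@complex.Re R)) := PP i j; rewrite !mxE raddf_sum.
  rewrite (_ : complex.Re (_%:R) = (i == j)%:R); last by case: (i == j).
  move=> <-; rewrite -big_split; apply: eq_bigr => k _; rewrite !mxE /=.
  by case: (P k i) => x y; case: (P k j) => z t /=; rewrite mulNr opprK.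
(* A row of [U] may vanish, so the eigenvector is taken over R[i]: a row of the invertible [P] is
   nonzero, and [eigenvalue_map] descends to R. *)
- have eigD k : eigenvalue A (D 0 k).
    rewrite -(eigenvalue_map (real_complex R)); apply/eigenvalueP.
    exists (row k P).
      by rewrite -row_mul PA; apply/rowP => j;
        rewrite mxE mul_diag_mx !mxE DE mxE.
    apply/eqP => Pk0; have : row k (P *m invmx P) = 0 by rewrite row_mul Pk0
      mul0mx.
    by rewrite mulmxV // => /rowP/(_ k) /eqP; rewrite !mxE eqxx oner_eq0.
  by move=> i; case: (split_ordP i) => k ->; rewrite ?row_mxEl ?row_mxEr.
Qed.

(** * Trigonometric inequalities *)

(** Concavity of sin on [0, pi]: by the mean value theorem the slopes over [0, u] and [u, v] are
    values of cos, which decreases there. *)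
Lemma sin_secant_le (R : realType) (u v : R) :
  0 <= u <= v -> v <= pi -> u * sin v <= v * sin u.
Proof.
move=> /andP[]; rewrite le_eqVlt => /predU1P[<- _ _|u0].
  by rewrite sin0 mul0r mulr0.
rewrite le_eqVlt => /predU1P[-> //|uv] vpi.
have cont (a b : R) : {within `[a, b], continuous sin}.
  by apply: continuous_subspaceT => x; exact: continuous_sin.
have [x] := MVT u0 (fun x _ => is_derive_sin x) (cont _ _).
have [y] := MVT uv (fun x _ => is_derive_sin x) (cont _ _).
rewrite !in_itv /= sin0 !subr0 => /andP[uy yv] vuE /andP[x0 xu] uE.
have cyx : cos y <= cos x.
  apply/ltW; rewrite ltr_cos ?(lt_trans xu uy)// in_itv /=; apply/andP; split;
    lra.
have : (v - u) * cos y <= (v - u) * cos x by apply: ler_wpM2l cyx; lra.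
rewrite -[sin v](subrK (sin u)) vuE uE => H.
have := ler_wpM2l (ltW u0) H; lra.
Qed.

(* Substituting y^2 = lam / r compares one flow of duration pi / (2 sqrt r)
   with the gradient step lam |-> 1 - lam / r. *)
Lemma norm_cos_pihalf_le (R : realType) (y : R) :
  0 <= y -> `|cos (pi / 2 * y)| <= `|1 - y ^+ 2|.
Proof.
move=> y0; have [p0 p2] := (@pi_gt0 R, @pihalf_lt2 R).
have [y1|y1] := leP y 1.
  (* Half angle: cos (pi/2 * y) = 1 - 2 sin^2 (pi/4 * y), and concavity gives sin (pi/4 * y) >= y
     sin (pi/4), whose square is y^2 / 2. *)
  have c0 : 0 <= cos (pi / 2 * y).
    by apply: cos_ge0_pihalf; apply/andP; split; nra.
  rewrite !ger0_norm //; last by nra.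
  have sq4 : sin (pi / 4 : R) ^+ 2 = 2^-1.
    have := @cos_pihalf R; rewrite (_ : pi / 2 = (pi / 4) *+ 2); last by field.
    by rewrite cos_mulr2n cos2sin2 => h; lra.
  have s0 : 0 <= sin (pi / 4 : R) by apply: sin_ge0_pi; lra.
  have : pi / 4 * y * sin (pi / 4 : R) <= pi / 4 * sin (pi / 4 * y).
    by apply: sin_secant_le; [apply/andP; split; nra|lra].
  rewrite -mulrA ler_pM2l; last by lra.
  move=> h; have {h} : (y * sin (pi / 4)) ^+ 2 <= sin (pi / 4 * y) ^+ 2.
    have ys0 : 0 <= y * sin (pi / 4) by rewrite mulr_ge0.
    by rewrite ler_sqr // nnegrE // (le_trans ys0).
  rewrite exprMn sq4 (_ : pi / 2 * y = (pi / 4 * y) *+ 2); last by field.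
  by rewrite cos_mulr2n cos2sin2; lra.
(* For y > 1 the cosine is -sin (pi/2 * (y - 1)). With |sin x| <= x, it remains that pi/2 * (y - 1)
   <= (y + 1)(y - 1), true since pi/2 < 2 < y + 1. *)
have -> : pi / 2 * y = pi / 2 * (y - 1) + pi / 2 by ring.
rewrite cosDpihalf normrN [leRHS]ler0_norm; last by nra.
have sx (x : R) : 0 <= x -> `|sin x| <= x.
  move=> x0; have [x1|x1] := leP x 1; last by rewrite (le_trans (sin_max x))
    // ltW.
  rewrite ger0_norm; last by apply: sin_ge0_pi; have := @pi_ge2 R; lra.
  have cont : {within `[0, x], continuous (sin : R -> R)}.
    by apply: continuous_subspaceT => z; exact: continuous_sin.
  have [z _] := MVT_segment x0 (fun x _ => is_derive_sin x) cont.
  by rewrite sin0 !subr0 => ->; rewrite ler_piMl // cos_le1.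
apply: le_trans (sx _ _) _; nra.
Qed.

(** * Chebyshev polynomials and their roots *)

Lemma chebyshev_polySS (R : realType) n :
  chebyshev_poly R n.+2 =
  2 *: 'X * chebyshev_poly R n.+1 - chebyshev_poly R n.
Proof. by []. Qed.

(** Two-step induction matching the recurrence; the polynomial is a separate argument of [P], so
    each case only sees the values [p] and [q]. *)
Lemma chebyshev_ind (R : realType) (P : nat -> {poly R} -> Prop) :
  P 0%N 1 -> P 1%N 'X ->
  (forall n p q, P n p -> P n.+1 q -> P n.+2 (2 *: 'X * q - p)) ->
  forall n, P n (chebyshev_poly R n).
Proof.
move=> P0 P1 PS n; suff [] : P n (chebyshev_poly R n) /\
  P n.+1 (chebyshev_poly R n.+1) by [].
by elim: n => [//|n [IH IH1]]; split=> //; rewrite chebyshev_polySS; exact: PS.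
Qed.

Lemma horner_chebyshev_step (R : realType) (p q : {poly R}) x :
  (2 *: 'X * q - p).[x] = 2 * x * q.[x] - p.[x].
Proof. by rewrite !hornerE. Qed.

Lemma chebyshev_cos (R : realType) n (t : R) :
  (chebyshev_poly R n).[cos t] = cos (n%:R * t).
Proof.
elim/chebyshev_ind: (chebyshev_poly R n);
  rewrite ?hornerE ?mul0r ?cos0 ?mul1r //.
move=> {}n p q pE qE; rewrite horner_chebyshev_step pE qE.
have -> : n.+2%:R * t = n.+1%:R * t + t by rewrite -[n.+2]addn1 natrD; ring.
have -> : n%:R * t = n.+1%:R * t - t by rewrite -[n.+1]addn1 natrD; ring.
by rewrite cosB cosD; ring.
Qed.

(** Hyperbolic counterpart of [chebyshev_cos], for arguments outside [-1, 1]: q^n and q^-n both obey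
    the recurrence at x = (q + 1/q) / 2. *)
Lemma chebyshev_joukowski (R : realType) n (q : R) : q != 0 ->
  (chebyshev_poly R n).[(q + q^-1) / 2] = (q ^+ n + q ^- n) / 2.
Proof.
move=> q0; elim/chebyshev_ind: (chebyshev_poly R n).
- by rewrite hornerE expr0 invr1; field.
- by rewrite hornerE expr1.
move=> {}n p r pE rE; rewrite horner_chebyshev_step pE rE !exprS.
by field; rewrite q0 expf_neq0.
Qed.

Lemma size_chebyshev_poly (R : realType) n : size (chebyshev_poly R n) = n.+1.
Proof.
elim/chebyshev_ind: (chebyshev_poly R n); rewrite ?size_poly1 ?size_polyX //.
move=> {}n p q sp sq; have q0 : q != 0 by rewrite -size_poly_eq0 sq.
have sXq : size (2 *: 'X * q) = n.+3.
  by rewrite -scalerAl size_scale ?pnatr_eq0 // mulrC size_mulX // sq.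
by rewrite size_polyDl ?sXq // size_polyN sp.
Qed.

Lemma chebyshev_norm_le1 (R : realType) n (x : R) :
  -1 <= x <= 1 -> `|(chebyshev_poly R n).[x]| <= 1.
Proof.
by move=> x1; rewrite -(@acosK R x) ?in_itv // chebyshev_cos cos_max.
Qed.

Lemma chebyshev1 (R : realType) n : (chebyshev_poly R n).[1] = 1 :> R.
Proof. by rewrite -[X in _.[X]](@cos0 R) chebyshev_cos mulr0 cos0. Qed.

Lemma horner_distinct_roots (R : fieldType) n (p : {poly R}) (c : 'I_n -> R) x :
  size p = n.+1 -> injective c -> (forall i, root p (c i)) ->
  p.[x] = lead_coef p * \prod_(i < n) (x - c i).
Proof.
move=> sp c_inj pc.
rewrite [in LHS](@all_roots_prod_XsubC _ p [seq c i | i <- enum 'I_n]).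
- rewrite hornerZ big_map horner_prod big_enum /=; congr (_ * _).
  by apply: eq_bigr => i _; rewrite !hornerE.
- by rewrite size_map size_enum_ord.
- by apply/allP => _ /mapP[i _ ->].
- by rewrite uniq_rootsE map_inj_uniq // enum_uniq.
Qed.

Lemma cheb_root_gt0 (R : realType) (m L : R) K k :
  0 < m -> m < L -> 0 < cheb_root m L K k.
Proof.
move=> m0 mL; rewrite /cheb_root.
have := cos_le1 ((k%:R - 2^-1) * pi / K%:R : R); nra.
Qed.

(** With t_k the k-th Chebyshev angle, h(lam) - cos t_k = 2 (r_k - lam) / (L - m), so dividing by
    the value at lam = 0 leaves 1 - lam / r_k. *)
Lemma scaled_chebyshev_prod (R : realType) (m L lam : R) K :
  0 < m -> m < L ->
  scaled_chebyshev m L K lam = \prod_(k < K) (1 - lam / cheb_root m L K k.+1).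
Proof.
move=> m0 mL.
pose t (k : 'I_K) : R := (k.+1%:R - 2^-1) * pi / K%:R.
(* On [0, pi] cos is injective, which makes the K roots distinct. *)
have tI k : t k \in `[0, pi].
  have K0 : 0 < K%:R :> R by rewrite ltr0n (leq_ltn_trans _ (ltn_ord k)).
  have kK : k.+1%:R <= K%:R :> R by rewrite ler_nat.
  have k1 : 1 <= k.+1%:R :> R by rewrite ler1n.
  have := @pi_gt0 R => p0.
  rewrite in_itv /= /t; apply/andP; split.
    by rewrite divr_ge0 ?mulr_ge0 //; lra.
  by rewrite ler_pdivrMr // mulrC ler_pM2l //; lra.
have ct_inj : injective (fun k => cos (t k)).
  move=> i j /cos_inj; rewrite !tI => /(_ isT isT) tij.
  have K0 : K%:R != 0 :> R by rewrite pnatr_eq0 -lt0n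
    (leq_ltn_trans _ (ltn_ord i)).
  apply/val_inj/eqP => /=; rewrite -eqSS -(eqr_nat R); apply/eqP.
  have := congr1 (fun z => z * K%:R) tij; rewrite /t !divfK //.
  by move/(mulIf (lt0r_neq0 (@pi_gt0 R)))/addIr.
have ct_root k : root (chebyshev_poly R K) (cos (t k)).
  have K0 : K%:R != 0 :> R by rewrite pnatr_eq0 -lt0n
    (leq_ltn_trans _ (ltn_ord k)).
  rewrite /root chebyshev_cos /t mulrC divfK // -natr1.
  (* K t_k is pi/2 plus k half-turns, with [k] counted from 0. *)
  rewrite (_ : _ * pi = pi / 2 + pi *+ k); last by rewrite -mulr_natr; field.
  rewrite alternatingn; last exact: cosDpi.
  by rewrite cos_pihalf mulr0.
rewrite /scaled_chebyshev !(horner_distinct_roots _ (size_chebyshev_poly R K)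
  ct_inj ct_root).
rewrite -mulf_div divff ?mul1r; last first.
  by rewrite lead_coef_eq0 -size_poly_eq0 size_chebyshev_poly.
rewrite -prodf_div; apply: eq_bigr => k _.
have := @cheb_root_gt0 _ m L K k.+1 m0 mL;
  rewrite /cheb_root -/(t k) /cheb_shift => r0.
by field; apply/andP; split; apply: lt0r_neq0; lra.
Qed.

(** * Matrix derivatives and the gradient of the quadratic *)

Lemma is_derive_mxP (R : realFieldType) (m n : nat) (M : R -> 'M[R]_(m, n))
    (t : R) (dM : 'M[R]_(m, n)) :
  is_derive t 1 M dM <-> forall i j, is_derive t 1 (fun s => M s i j) (dM i j).
Proof.
split=> [[Md <-] i j|Md].
  split; first by move/derivable_mxP: Md.
  by rewrite derive_mx // mxE.
have Md' : derivable M t 1 by apply/derivable_mxP => i j; have [] := Md i j.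
split=> //; rewrite derive_mx //; apply/matrixP => i j; rewrite mxE.
by have [_ ->] := Md i j.
Qed.

Lemma is_derive_mulmx (R : realFieldType) (m n p : nat) (U : 'M[R]_(m, n))
    (x : R -> 'M[R]_(n, p)) (t : R) (dx : 'M[R]_(n, p)) :
  is_derive t 1 x dx -> is_derive t 1 (fun s => U *m x s) (U *m dx).
Proof.
move=> /is_derive_mxP xd; apply/is_derive_mxP => i j.
have -> : (fun s => (U *m x s) i j) = \sum_k (U i k \*: (fun s => x s k j)).
  by apply/funext => s; rewrite mxE fct_sumE.
rewrite mxE; exact: is_derive_sum.
Qed.

Lemma grad_quadratic (R : realType) (d : nat) (A : 'M[R]_d) (b x : 'cV[R]_d) :
  A^T = A -> grad (quadratic A b) x = A *m x - b.
Proof.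
move=> symA; apply/colP => i; rewrite mxE.
set e := delta_mx i 0.
have eM (z : 'cV[R]_d) : (e^T *m z) 0 0 = z i 0.
  by rewrite trmx_delta -rowE mxE.
have tr (M : 'M[R]_1) : M 0 0 = M^T 0 0 by rewrite mxE.
have be : (b^T *m e) 0 0 = b i 0 by rewrite tr trmx_mul trmxK eM.
have xAe : (x^T *m A *m e) 0 0 = (A *m x) i 0.
  by rewrite tr !trmx_mul trmxK symA eM.
have DE (M N : 'M[R]_1) : (M + N) 0 0 = M 0 0 + N 0 0 by rewrite mxE.
have ZE (c : R) (M : 'M[R]_1) : (c *: M) 0 0 = c * M 0 0 by rewrite mxE.
(* On the line through [x] along [e], the objective is this polynomial in h; symmetry of [A] merges
   the two cross terms. The partial derivative is its linear coefficient. *)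
pose p : {poly R} := (2^-1 * (e^T *m A *m e) 0 0) *: 'X^2
  + ((A *m x) i 0 - b i 0) *: 'X + (quadratic A b x)%:P.
have pE h : quadratic A b (h *: e + x) = p.[h].
  rewrite /p !hornerE /quadratic.
  rewrite [_^T]linearD /= [(h *: _)^T]linearZ /= !mulmxDl !mulmxDr -!scalemxAl
    -!scalemxAr.
  rewrite -[e^T *m A *m x]mulmxA !(DE, ZE) eM be xAe.
  by field.
have p0 : quadratic A b x = p.[0] by rewrite -pE scale0r add0r.
transitivity ('D_1 (horner p) 0).
  rewrite /derive; apply: (congr1 (fun F : R -> R => lim (F @ 0^')));
    apply/funext => h /=.
  by rewrite pE p0 /GRing.scale /= mulr1 addr0.
rewrite derive_val /p !poly.derivE !hornerE [RHS]mxE [X in _ = _ + X]mxE /=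
  mulr0 mul0r add0r //.
Qed.

(** * The Hamiltonian flow of a quadratic *)

Lemma is_derive_scalel (R : realType) (a t : R) : is_derive t 1 ( *%R a) a.
Proof.
suff : is_derive t (1 : R) (a \*: (id : R -> R)) a by [].
by apply: is_derive_eq; rewrite /GRing.scale /= mulr1.
Qed.

(** Stated for an arbitrary solution, hence a uniqueness result: it fixes the flow's value whichever
    solution choice picks. *)
Lemma harmonic_oscillator (R : realType) (s eta : R) (y w : R -> R) :
  0 < s -> 0 <= eta -> w 0 = 0 ->
  (forall t, 0 <= t <= eta ->
     is_derive t 1 y (w t) /\ is_derive t 1 w (- (s ^+ 2 * y t))) ->
  y eta = cos (s * eta) * y 0.
Proof.
move=> s0 eta0 w0 yw.
pose st t := s * t.
have dst (t : R) : is_derive t 1 st s by exact: is_derive_scalel.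
have dcos (t : R) : is_derive t 1 (cos \o st) (- sin (s * t) * s).
  exact: is_derive1_comp.
have dsin (t : R) : is_derive t 1 (sin \o st) (cos (s * t) * s).
  exact: is_derive1_comp.
have const (g : R -> R) : (forall t, 0 <= t <= eta -> is_derive t 1 g 0) ->
    g eta = g 0.
  move=> dg; apply/eqP; rewrite -subr_eq0; apply/eqP.
  have [||c _ ->] := @MVT_segment _ g (fun=> 0) 0 eta eta0;
    last by rewrite mul0r.
    by move=> t; rewrite in_itv /= => /andP[a b]; apply: dg; rewrite !ltW.
  apply: derivable_within_continuous => t; rewrite in_itv /= => /dg.
  by case.
(* The oscillator is solved by rotating (s y, w) back through the angle s t. *)
have F : s * y eta * cos (s * eta) - w eta * sin (s * eta) = s * y 0.
  have := const (s \*: y * (cos \o st) - w * (sin \o st)).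
  rewrite !fctE /st /= !mulr0 w0 cos0 mulr1 mul0r subr0; apply => t /yw[dy dw].
  apply: is_derive_eq; rewrite /GRing.scale /=; ring.
have G : s * y eta * sin (s * eta) + w eta * cos (s * eta) = 0.
  have := const (s \*: y * (sin \o st) + w * (cos \o st)).
  rewrite !fctE /st /= !mulr0 w0 sin0 mulr0 mul0r addr0; apply => t /yw[dy dw].
  apply: is_derive_eq; rewrite /GRing.scale /=; ring.
apply: (mulfI (lt0r_neq0 s0)); have := cos2Dsin2 (s * eta); move: F G.
set c := cos _; set z := sin _ => F G cz.
rewrite mulrCA -F.
transitivity (s * y eta * (c ^+ 2 + z ^+ 2) - z * (s * y eta * z + w eta * c)).
  by rewrite cz G; ring.
by ring.
Qed.

Lemma grad_quadratic_center (R : realType) (d : nat) (A : 'M[R]_d)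
    (b xs x : 'cV[R]_d) :
  A^T = A -> A *m xs = b ->
  grad (quadratic A b) x = A *m (x - xs).
Proof. by move=> symA Axs; rewrite grad_quadratic // mulmxBr Axs. Qed.

(** Pairing the deviation with a left eigenvector decouples the system into a scalar oscillator of
    frequency sqrt lam. *)
Lemma hamiltonian_solution_eigenmode (R : realType) (d : nat)
    (A : 'M[R]_d) (b xs : 'cV[R]_d) (u : 'rV[R]_d) (lam eta : R)
    (x0 : 'cV[R]_d) (x v : R -> 'cV[R]_d) :
  A^T = A -> A *m xs = b ->
  u *m A = lam *: u -> 0 < lam -> 0 <= eta ->
  hamiltonian_solution (quadratic A b) eta x0 0 x v ->
  u *m (x eta - xs) = cos (Num.sqrt lam * eta) *: (u *m (x0 - xs)).
Proof.
move=> symA Axs uA lam0 eta0 [xE0 vE0 xv]; apply/matrixP => i j;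
  rewrite !ord1 [RHS]mxE.
pose y t := (u *m (x t - xs)) 0 0; pose w t := (u *m v t) 0 0.
suff : y eta = cos (Num.sqrt lam * eta) * y 0 by rewrite /y xE0.
apply: (@harmonic_oscillator _ _ _ y w) => //.
- by rewrite sqrtr_gt0.
- by rewrite /w vE0 mulmx0 mxE.
move=> t /xv[dx dv]; split.
  have dxs : is_derive t 1 (fun s => x s - xs) (v t).
    by apply: is_derive_eq; rewrite subr0.
  by have /is_derive_mxP := is_derive_mulmx u dxs; apply.
have /is_derive_mxP/(_ 0 0) := is_derive_mulmx u dv.
rewrite (grad_quadratic_center _ symA Axs) mulmxN mulmxA uA -scalemxAl mxE.
by rewrite [X in - X]mxE sqr_sqrtr // ltW.
Qed.

(** Needed to rule out the default value of [hamiltonian_flow]. The solution is synthesized from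
    frame coordinates: U^T U = 1 gives the initial position and A U^T = U^T diag(D) the equation. *)
Lemma hamiltonian_solution_exists (R : realType) (d n : nat) (A : 'M[R]_d)
    (b xs : 'cV[R]_d) (U : 'M[R]_(n, d)) (D : 'I_n -> R) (eta : R)
    (x0 : 'cV[R]_d) :
  A^T = A -> A *m xs = b ->
  (forall i j, (U *m A) i j = D i * U i j) -> U^T *m U = 1%:M ->
  (forall i, 0 < D i) ->
  exists x v, hamiltonian_solution (quadratic A b) eta x0 0 x v.
Proof.
move=> symA Axs UA UU D0; pose z := U *m (x0 - xs); pose s i := Num.sqrt (D i).
have s0 i : s i ^+ 2 = D i by rewrite sqr_sqrtr // ltW.
pose c (t : R) : 'cV_n := \col_i (cos (s i * t) * z i 0).
pose c' (t : R) : 'cV_n := \col_i (- s i * sin (s i * t) * z i 0).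
exists (fun t => xs + U^T *m c t), (fun t => U^T *m c' t).
have AU : A *m U^T = \matrix_(i, j) (D j * U j i).
  by apply/matrixP => i j; rewrite -[A]symA -trmx_mul [LHS]mxE UA [RHS]mxE.
split.
- rewrite (_ : c 0 = z); first by rewrite mulmxA UU mul1mx addrC subrK.
  by apply/colP => i; rewrite mxE mulr0 cos0 mul1r.
- rewrite (_ : c' 0 = 0) ?mulmx0 //.
  by apply/colP => i; rewrite !mxE mulr0 sin0 mulr0 mul0r.
move=> t _.
have dst a := is_derive_scalel a t.
split.
  have dc : is_derive t (1 : R) c (c' t).
    apply/is_derive_mxP => i j; rewrite mxE.
    have -> : (fun s0 => c s0 i j) = z i 0 \*: (cos \o *%R (s i)).
      by apply/funext => t'; rewrite mxE mulrC.
    by apply: is_derive_eq; rewrite /GRing.scale /=; ring.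
  have dU := is_derive_mulmx U^T dc.
  by apply: is_derive_eq; rewrite add0r.
have dc' : is_derive t (1 : R) c' (\col_i (- D i * c t i 0)).
  apply/is_derive_mxP => i j; rewrite mxE [c t i 0]mxE.
  have -> : (fun s0 => c' s0 i j) = (- s i * z i 0) \*: (sin \o *%R (s i)).
    by apply/funext => t'; rewrite mxE /= mulrAC.
  apply: is_derive_eq; rewrite -s0 /GRing.scale /=; ring.
have := is_derive_mulmx U^T dc'.
rewrite (grad_quadratic_center _ symA Axs) addrC addKr mulmxA AU.
rewrite (_ : U^T *m _ = - (\matrix_(i, j) (D j * U j i) *m c t)) //.
apply/colP => i; rewrite !mxE -sumrN; apply: eq_bigr => k _; rewrite !mxE; ring.
Qed.

(** Each flow restarts from rest, so the per-flow factors in a frame coordinate simply multiply. *)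
Lemma frictionless_hd_eigenframe (R : realType) (d n : nat) (A : 'M[R]_d)
    (b xs : 'cV[R]_d) (U : 'M[R]_(n, d)) (D : 'I_n -> R) (etas : seq R)
    (x1 : 'cV[R]_d) i :
  A^T = A -> A *m xs = b ->
  (forall i j, (U *m A) i j = D i * U i j) -> U^T *m U = 1%:M ->
  (forall i, 0 < D i) -> all (fun eta => 0 <= eta) etas ->
  (U *m (frictionless_hd (quadratic A b) etas x1 - xs)) i 0 =
  (\prod_(eta <- etas) cos (Num.sqrt (D i) * eta)) * (U *m (x1 - xs)) i 0.
Proof.
move=> symA Axs UA UU D0; elim: etas x1 => [|eta etas IH] x1 /=.
  by rewrite big_nil mul1r.
move=> /andP[eta0 /IH{}IH]; rewrite IH big_cons.
have [x [v xv]] := hamiltonian_solution_exists eta x1 symA Axs UA UU D0.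
(* Existence makes [xget] return the endpoint of a genuine solution, possibly not the one just
   built. *)
have /(xgetPex (0, 0)) : exists z, [set z | exists x v : R -> 'cV[R]_d,
    hamiltonian_solution (quadratic A b) eta x1 0 x v /\ z = (x eta, v eta)] z.
  by exists (x eta, v eta), x, v.
rewrite -/(hamiltonian_flow _ _ _ _) => -[{xv}x [{}v [xv ->]]] /=.
have uA : row i U *m A = D i *: row i U.
  by rewrite -row_mul; apply/rowP => j; rewrite mxE UA !mxE.
have := hamiltonian_solution_eigenmode symA Axs uA (D0 i) eta0 xv.
rewrite -!row_mul => /matrixP/(_ 0 0);
  rewrite [LHS]mxE [RHS]mxE [X in _ * X]mxE => ->.
by rewrite mulrCA mulrA.
Qed.

(** * Norms, extremal value and conclusion *)

(** A tight frame preserves the norm as a basis would, so errors can be bounded one frame coordinate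
    at a time. *)
Lemma norm2_isometry (R : realType) (n d : nat) (U : 'M[R]_(n, d)) (z : 'cV_d) :
  U^T *m U = 1%:M -> norm2 (U *m z) = norm2 z.
Proof.
have sq (k : nat) (y : 'cV[R]_k) : \sum_i y i 0 ^+ 2 = (y^T *m y) 0 0.
  by rewrite mxE; apply: eq_bigr => i _; rewrite mxE.
by move=> UU; rewrite /norm2 !sq trmx_mul -mulmxA [U^T *m _]mulmxA UU mul1mx.
Qed.

Lemma norm2_le_scale (R : realType) (n : nat) (M : R) (y z : 'cV[R]_n) :
  0 <= M -> (forall i, `|y i 0| <= M * `|z i 0|) -> norm2 y <= M * norm2 z.
Proof.
move=> M0 yz; rewrite /norm2 -(ger0_norm M0) -sqrtr_sqr -sqrtrM ?sqr_ge0 //.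
rewrite ler_wsqrtr // mulr_sumr ler_sum // => i _.
rewrite -exprMn -(real_normK (num_real (y i 0)))
  -(real_normK (num_real (M * _))).
by rewrite normrM (ger0_norm M0) lerXn2r ?nnegrE // mulr_ge0.
Qed.

(** h maps [m, L] into [-1, 1], where |T_K| <= 1, and h(m) = 1, where T_K = 1. *)
Lemma is_max_scaled_chebyshev (R : realType) (m L : R) K :
  m < L ->
  is_max [set `|scaled_chebyshev m L K lam| | lam in `[m, L]]
    `|(chebyshev_poly R K).[cheb_shift m L 0]|^-1.
Proof.
move=> mL; have Lm : 0 < L - m by rewrite subr_gt0.
split=> [|_ [lam lamI <-]].
  exists m; first by rewrite /= in_itv /= lexx ltW.
  rewrite /scaled_chebyshev (_ : cheb_shift m L m = 1).
    by rewrite chebyshev1 mul1r normfV.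
  by rewrite /cheb_shift; field; rewrite lt0r_neq0.
move: lamI; rewrite /= in_itv /= => /andP[mlam lamL].
rewrite /scaled_chebyshev normrM normfV ler_piMl ?invr_ge0 //.
apply: chebyshev_norm_le1; rewrite /cheb_shift ler_pdivlMr // ler_pdivrMr //.
by apply/andP; split; lra.
Qed.

Lemma chebyshev_shift0 (R : realType) (m L : R) K :
  0 < m -> m < L ->
  let q := (Num.sqrt (L / m) + 1) / (Num.sqrt (L / m) - 1) in
  (chebyshev_poly R K).[cheb_shift m L 0] = (q ^+ K + q ^- K) / 2 /\ 0 < q.
Proof.
move=> m0 mL; set s := Num.sqrt _ => q.
have k1 : 1 < L / m by rewrite ltr_pdivlMr ?mul1r.
have s1 : 1 < s by rewrite -[1]sqrtr1 ltr_sqrt // (lt_trans _ k1).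
have q0 : 0 < q by rewrite /q divr_gt0; lra.
split=> //; rewrite -chebyshev_joukowski ?lt0r_neq0 //; congr (_.[_]).
(* Eliminating [L] leaves (s^2 + 1) / (s^2 - 1) = (q + 1/q) / 2, a rational identity in s. *)
have LE : L = s ^+ 2 * m by rewrite sqr_sqrtr ?divfK ?lt0r_neq0 // divr_ge0;
  lra.
rewrite /cheb_shift /q LE; field.
by apply/and3P; split; apply: lt0r_neq0; nra.
Qed.

(** Reindexing by [sigma] aligns the two products, which are then compared factor by factor; this is
    why any order of the times works. *)
Lemma prod_cos_chebyshev (R : realType) (m L lam : R) K (sigma : 'S_K) :
  0 < m -> m < L -> 0 <= lam ->
  `|\prod_(k < K) cos (Num.sqrt lam *
      (pi / 2 * (1 / Num.sqrt (cheb_root m L K (sigma k).+1))))|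
  <= `|scaled_chebyshev m L K lam|.
Proof.
move=> m0 mL lam0; rewrite scaled_chebyshev_prod //
  [in leRHS](reindex_perm sigma) /=.
rewrite !normr_prod; apply: ler_prod => k _; rewrite normr_ge0 /=.
set r := cheb_root _ _ _ _; have r0 : 0 < r by exact: cheb_root_gt0.
have -> : Num.sqrt lam * (pi / 2 * (1 / Num.sqrt r))
    = pi / 2 * (Num.sqrt lam / Num.sqrt r) by rewrite mul1r mulrCA.
have -> : lam / r = (Num.sqrt lam / Num.sqrt r) ^+ 2.
  by rewrite expr_div_n !sqr_sqrtr // ltW.
by apply: norm_cos_pihalf_le; rewrite divr_ge0 ?sqrtr_ge0.
Qed.

Lemma posdefmx_eigenvalue_gt0 (R : realType) (d : nat) (A : 'M[R]_d) (a : R) :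
  posdefmx A -> eigenvalue A a -> 0 < a.
Proof.
move=> [_ posA] /eigenvalueP[u uA u0].
have := posA u^T; rewrite trmx_eq0 trmxK uA -scalemxAl mxE => /(_ u0).
apply: contraLR; rewrite -!leNgt => a0; apply: mulr_le0_ge0 => //.
by rewrite mxE sumr_ge0 // => i _; rewrite mxE -expr2 sqr_ge0.
Qed.

Lemma posdefmx_unitmx (R : realType) (d : nat) (A : 'M[R]_d) :
  posdefmx A -> A \in unitmx.
Proof.
move=> [_ posA]; rewrite -row_free_unit -kermx_eq0; apply/eqP/row_matrixP => i.
rewrite row0; apply/eqP; apply: contraT => ki0.
have := posA (row i (kermx A))^T; rewrite trmx_eq0 => /(_ ki0).
by rewrite trmxK -row_mul mulmx_ker row0 mul0mx mxE ltxx.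
Qed.

Theorem theorem1 (R : realType) (d : nat) (A : 'M[R]_d) (b : 'cV[R]_d)
    (m L : R) (K : nat) (sigma : 'S_K) (x1 : 'cV[R]_d) :
  posdefmx A ->
  is_min (spectrum A) m ->
  is_max (spectrum A) L ->
  m < L ->
  (1 <= K)%N ->
  let f := quadratic A b in
  let xstar := invmx A *m b in
  let kappa := L / m in
  let q := (Num.sqrt kappa + 1) / (Num.sqrt kappa - 1) in
  (* ordinals are 0-based: the k-th time uses the node of index sigma(k) + 1 *)
  let eta (k : 'I_K) : R :=
    pi / 2 * (1 / Num.sqrt (cheb_root m L K (sigma k).+1)) in
  let xout := frictionless_hd f [seq eta k | k <- enum 'I_K] x1 in
  exists M : R,
    [/\ is_max [set `|scaled_chebyshev m L K lam| | lam in `[m, L]] M,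
        norm2 (xout - xstar) <= M * norm2 (x1 - xstar) &
        M * norm2 (x1 - xstar)
          <= 2 / (q ^+ K + q ^- K) * norm2 (x1 - xstar)].
Proof.
move=> posA [eigm mmin] [_ Lmax] mL K1 f xstar kappa q eta xout.
have m0 : 0 < m by exact: posdefmx_eigenvalue_gt0 eigm.
have [U [D [UA UU eigD]]] := symmetric_eigenframe posA.1.
have D0 i : 0 < D i by exact: posdefmx_eigenvalue_gt0 (eigD i).
have Axs : A *m xstar = b by rewrite /xstar mulKVmx // posdefmx_unitmx.
have [PhiE q0] := @chebyshev_shift0 _ m L K m0 mL.
have maxM := is_max_scaled_chebyshev K mL.
have qK0 : 0 < q ^+ K + q ^- K by rewrite addr_gt0 ?invr_gt0 ?exprn_gt0.
exists `|(chebyshev_poly R K).[cheb_shift m L 0]|^-1; split=> //; last first.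
  by rewrite PhiE ger0_norm ?invf_div // divr_ge0 // ltW.
rewrite -(norm2_isometry _ UU) -[norm2 (x1 - _)](norm2_isometry _ UU).
apply: norm2_le_scale => [|i]; first by rewrite invr_ge0.
rewrite (frictionless_hd_eigenframe _ _ posA.1 Axs UA UU D0); last first.
  apply/allP => _ /mapP[k _ ->].
  by rewrite mulr_ge0 ?divr_ge0 ?pi_ge0 ?sqrtr_ge0 // mul1r.
rewrite normrM ler_wpM2r // big_map big_enum /=.
apply: le_trans (prod_cos_chebyshev sigma m0 mL (ltW (D0 i))) _.
(* Each [D i] is an eigenvalue of [A], hence lies in [m, L], where the maximum applies. *)
apply: maxM.2; exists (D i) => //.
by rewrite /= in_itv /= (mmin _ (eigD i)) (Lmax _ (eigD i)).
Qed.
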